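(* If $K$ is an open max cone in $\mathbb{R}^n_+$ that does not contain any of the unit vectors $e^1,\dots,e^n$, then every generating set for $K$ is totally dependent.
   Context: $\mathbb{R}^n_+$ is the set of vectors with nonnegative real entries, with the topology induced from the Euclidean topology of $\mathbb{R}^n$ (a set is open in $\mathbb{R}^n_+$ if it is the intersection of an open subset of $\mathbb{R}^n$ with $\mathbb{R}^n_+$). $a\oplus b=\max(a,b)$, extended componentwise to vectors. A max cone is a subset of $\mathbb{R}^n_+$ closed under $\oplus$ and under multiplication by nonnegative reals. A max cone $K$ is called open if $K\setminus\{0\}$ is open in $\mathbb{R}^n_+$. The unit vector $e^p$ has $p$-th entry $1$ and all other entries $0$. $\operatorname{span}(S)$ is the set of all max combinations $\bigoplus_{x\in S}\lambda_x x$ with $\lambda_x\ge 0$ and only finitely many $\lambda_x\neq 0$; $\operatorname{span}(\emptyset)=\{0\}$. $S$ is a generating set for $K$ if $\operatorname{span}(S)=K$. A set $S$ is totally dependent if every $x\in S$ lies in $\operatorname{span}(S\setminus\{x\})$; in particular the empty set is totally dependent. *)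

(* Defs.v *)
From mathcomp Require Import all_boot all_order all_algebra.
From mathcomp Require Import all_classical all_reals all_analysis.

Set Implicit Arguments.
Unset Strict Implicit.
Unset Printing Implicit Defensive.

Import Order.TTheory GRing.Theory Num.Theory.
Import numFieldNormedType.Exports.

Local Open Scope classical_set_scope.
Local Open Scope ring_scope.

(* The topology on 'rV[R]_n is the entrywise (product) one, i.e. the Euclidean
   topology of R^n. *)

Definition nonneg_orthant (R : realType) (n : nat) : set 'rV[R]_n :=
  [set x | forall i, 0 <= x ord0 i].
Arguments nonneg_orthant : clear implicits.

Definition vmax (R : realType) (n : nat) (x y : 'rV[R]_n) : 'rV[R]_n :=
  map2_mx Num.max x y.

Definition max_cone (R : realType) (n : nat) (K : set 'rV[R]_n) : Prop :=
  [/\ K `<=` nonneg_orthant R n,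
      forall x y, K x -> K y -> K (vmax x y)
    & forall (a : R) x, 0 <= a -> K x -> K (a *: x)].

Definition open_in_orthant (R : realType) (n : nat) (A : set 'rV[R]_n) : Prop :=
  exists2 U : set 'rV[R]_n, open U & A = U `&` nonneg_orthant R n.

(* The cone itself need not be relatively open: the origin is removed first. *)
Definition open_max_cone (R : realType) (n : nat) (K : set 'rV[R]_n) : Prop :=
  max_cone K /\ open_in_orthant (K `\ 0).

(* 0 is neutral for vmax only on the nonnegative orthant, so this is meant for
   subsets S of the orthant. The big operator ranges over the x in S with
   lam x *: x != 0, which are finitely many by the second condition; in
   particular max_span set0 = [set 0]. *)
Definition max_span (R : realType) (n : nat) (S : set 'rV[R]_n) :
    set 'rV[R]_n :=
  [set y | exists lam : 'rV[R]_n -> R,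
    [/\ forall x, S x -> 0 <= lam x,
        finite_set [set x | S x /\ lam x != 0]
      & y = \big[@vmax R n/0]_(x \in S) (lam x *: x)]].

Definition generating_set (R : realType) (n : nat) (S K : set 'rV[R]_n) :
    Prop :=
  S `<=` nonneg_orthant R n /\ max_span S = K.

Definition totally_dependent (R : realType) (n : nat) (S : set 'rV[R]_n) :
    Prop :=
  forall x, S x -> max_span (S `\ x) x.

(* Main.v *)
Require Import Defs.
From mathcomp Require Import all_boot all_order all_algebra.
From mathcomp Require Import all_classical all_reals all_analysis.
From mathcomp Require Import lra.

Import Order.TTheory GRing.Theory Num.Theory.
Import numFieldNormedType.Exports.

Local Open Scope classical_set_scope.
Local Open Scope ring_scope.

(** A nonnegative vector [x] lies in the span of [S] iff for every [j] in its
    support some multiple of an element of [S] is below [x] and touches it at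
    [j]. Let [x] be in the generating set [S] and [j] in the support of [x].
    Lower all entries of [x] except the [j]-th one slightly: by openness the
    resulting [y <= x] stays in [K], so a multiple of some [s] in [S] is below
    [y] and touches [y], hence also [x], at [j]. As [K] contains no multiple of
    [e^j], some other entry of [x] was strictly lowered, whence [s != x]. *)

Section MaxSpan.
Context {R : realType} {n : nat}.
Implicit Types (S : set 'rV[R]_n) (x : 'rV[R]_n).

Lemma big_vmaxE (I : Type) (r : seq I) (F : I -> 'rV[R]_n) (i : 'I_n) :
  (\big[@vmax R n/0]_(k <- r) F k) ord0 i = \big[Num.max/0]_(k <- r) F k ord0 i.
Proof.
by apply: (big_morph (fun v : 'rV[R]_n => v ord0 i)) => [u v|]; rewrite mxE.
Qed.

(** The seed [0] need not be a value of [F]; any other result of the maximum comes from one of the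
    terms. *)
Lemma bigmax_attained (I : eqType) (r : seq I) (P : pred I) (F : I -> R) :
  \big[Num.max/0]_(k <- r | P k) F k != 0 ->
  exists k, [/\ k \in r, P k & \big[Num.max/0]_(k <- r | P k) F k = F k].
Proof.
elim: r => [|a r IH]; first by rewrite big_nil eqxx.
rewrite big_cons; case: ifP => Pa.
  case: leP => [le_Fa /IH[k [kr Pk ->]]|_ _].
    by exists k; rewrite inE kr orbT.
  by exists a; rewrite mem_head.
by move=> /IH[k [kr Pk ->]]; exists k; rewrite inE kr orbT.
Qed.

(** A big operator over an infinite support silently collapses to [0]. Finiteness of the nonzero
    coefficients rules this out, since a nonzero term has a nonzero coefficient. *)
Lemma max_span_supportP {S} {lam : 'rV[R]_n -> R} :
  finite_set [set s | S s /\ lam s != 0] ->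
  forall s, reflect (S s /\ lam s *: s <> 0)
    (s \in finite_support 0 S (fun s => lam s *: s)).
Proof.
move=> fin s; rewrite in_finite_support.
  by apply: (iffP idP) => [/set_mem|/mem_set].
apply: sub_finite_set fin => t /= [St lamt]; split => //.
by apply/eqP => lam0; apply: lamt; rewrite lam0 scale0r.
Qed.

(** Forwards, each nonzero entry of a max combination is attained by one term, and all terms lie
    below the maximum. Backwards, one touching multiple is chosen per coordinate of the support, and
    their maximum is [x]. *)
Lemma max_spanP S x :
  max_span S x <->
  nonneg_orthant R n x /\
  forall j, x ord0 j != 0 -> exists s l,
    [/\ S s, 0 <= l, forall i, l * s ord0 i <= x ord0 i
      & l * s ord0 j = x ord0 j].
Proof.
split=> [[lam [lam_ge0 fin ->]]|[x_ge0 touch]].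
  have suppP := max_span_supportP fin.
  split=> [i|j]; rewrite big_vmaxE; first exact: bigmax_ge_id.
  move=> /bigmax_attained[s [/suppP[Ss nz] _ ->]].
  exists s, (lam s); split; rewrite ?lam_ge0 ?mxE // => i.
  rewrite big_vmaxE.
  have -> : lam s * s ord0 i = (lam s *: s) ord0 i by rewrite mxE.
  by apply: (le_bigmax_seq _ _ _ (fun s => (lam s *: s) ord0 i)) => //;
    exact/suppP.
have /choice[f fP] : forall j, exists sl : 'rV[R]_n * R, x ord0 j != 0 ->
    [/\ S sl.1, 0 <= sl.2, forall i, sl.2 * sl.1 ord0 i <= x ord0 i
      & sl.2 * sl.1 ord0 j = x ord0 j].
  move=> j; have [->|/touch[s [l H]]] := eqVneq (x ord0 j) 0.
    by exists (0, 0).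
  by exists (s, l).
(* Several coordinates may be touched by the same element of [S]. *)
pose lam s := \big[Num.max/0]_(j | (x ord0 j != 0) && ((f j).1 == s)) (f j).2.
have lam_cases s : lam s != 0 ->
    exists j, [/\ x ord0 j != 0, (f j).1 = s & lam s = (f j).2].
  by move=> /bigmax_attained[j [_ /andP[nz /eqP fj] lamE]]; exists j.
have lam_le s i : lam s * s ord0 i <= x ord0 i.
  have [->|/lam_cases[j [nz <- ->]]] := eqVneq (lam s) 0.
    by rewrite mul0r x_ge0.
  by have [_ _] := fP j nz.
have fin : finite_set [set s | S s /\ lam s != 0].
  apply: (@sub_finite_set _ _ ((fst \o f) @` setT)); last first.
    exact/finite_image/finite_finset.
  by move=> s /= [_ /lam_cases[j [_ <- _]]]; exists j.
exists lam; split=> //.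
  by move=> s _; exact: bigmax_ge_id.
have suppP := max_span_supportP fin.
apply/rowP => j; rewrite big_vmaxE; apply/le_anti/andP; split; last first.
  by apply: bigmax_le => [|s _]; rewrite ?mxE ?lam_le ?x_ge0.
have [->|nz] := eqVneq (x ord0 j) 0; first exact: bigmax_ge_id.
have [Ss l_ge0 _ eq_j] := fP j nz.
have x_gt0 : 0 < x ord0 j by rewrite lt_def nz x_ge0.
(* [S] is not assumed nonnegative here, but this entry times a nonnegative scalar is positive. Its
   sign lets the coefficient grow from [(f j).2] to [lam (f j).1] without lowering the entry. *)
have s_ge0 : 0 <= (f j).1 ord0 j.
  rewrite leNgt; apply/negP => s_lt0; move: x_gt0.
  by rewrite -eq_j ltNge mulr_ge0_le0 // ltW.
have le_j : x ord0 j <= (lam (f j).1 *: (f j).1) ord0 j.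
  rewrite mxE -eq_j ler_wpM2r // (le_bigmax_cond _ (fun j => (f j).2)) //.
  by rewrite nz eqxx.
apply: (le_trans le_j).
apply: (le_bigmax_seq _ _ _ (fun s => (lam s *: s) ord0 j)) => //.
apply/suppP; split=> // /rowP /(_ j) lam0.
by move: (lt_le_trans x_gt0 le_j); rewrite lam0 mxE ltxx.
Qed.

Lemma generating_set_sub S (K : set 'rV[R]_n) : generating_set S K -> S `<=` K.
Proof.
move=> [S_ge0 <-] x Sx; apply/max_spanP; split=> [|j _]; first exact: S_ge0.
by exists x, 1; split=> // [i|]; rewrite mul1r.
Qed.

(** Otherwise [x] is a positive multiple of the [j]-th unit vector, and rescaling by the inverse
    puts that vector in [K]. *)
Lemma max_cone_support (K : set 'rV[R]_n) (j : 'I_n) x :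
  max_cone K -> ~ K (delta_mx ord0 j) -> K x -> x ord0 j != 0 ->
  exists2 i, i != j & x ord0 i != 0.
Proof.
move=> [K_ge0 _ KZ] notKj Kx nz; apply: contrapT => only_j; apply: notKj.
suff -> : delta_mx ord0 j = (x ord0 j)^-1 *: x.
  by apply: KZ => //; rewrite invr_ge0 K_ge0.
apply/rowP => i; rewrite !mxE eqxx /=.
have [->|ij] := eqVneq i j; first by rewrite mulVf.
have [->|nzi] := eqVneq (x ord0 i) 0; first by rewrite mulr0.
by case: only_j; exists i.
Qed.

Lemma open_max_cone_lower {K : set 'rV[R]_n} {x} (j : 'I_n) :
  open_max_cone K -> K x -> x ord0 j != 0 ->
  exists y : 'rV[R]_n, [/\ K y, y ord0 j = x ord0 j,
    forall i, y ord0 i <= x ord0 i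
    & forall i, i != j -> x ord0 i != 0 -> y ord0 i < x ord0 i].
Proof.
move=> [_ [U openU KU]] Kx nz.
have [Ux x_ge0] : (U `&` nonneg_orthant R n) x.
  by rewrite -KU; split=> // x0; move: nz; rewrite x0 mxE eqxx.
have /nbhs_ballP[e /= e_gt0 ball_U] : nbhs x U by exact: open_nbhs_nbhs.
(* Truncation at [0] keeps [y] in the orthant. Every entry moves by at most [e / 2], so [y] stays in
   the entrywise ball of radius [e], and positive entries off [j] strictly drop. *)
pose y : 'rV[R]_n :=
  \row_i if i == j then x ord0 i else Num.max 0 (x ord0 i - e / 2).
exists y; split=> [||i|i /negPf ij nzi]; rewrite ?mxE ?eqxx ?ij //.
- suff [] : (K `\ 0) y by [].
  rewrite KU; split=> [|i]; last first.
    by rewrite mxE; case: ifP => _; rewrite ?x_ge0 // le_max lexx.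
  apply: ball_U; split=> // a i; rewrite (ord1 a) /ball /= mxE.
  have xi_ge0 := x_ge0 i; case: ifP => _; first by rewrite subrr normr0.
  by rewrite ltr_norml; case: (leP 0 (_ - _)) => ?; apply/andP; split; lra.
- by have xi_ge0 := x_ge0 i; case: ifP => _ //; case: (leP 0 (_ - _)) => ?; lra.
- have : 0 < x ord0 i by rewrite lt_def nzi x_ge0.
  by case: (leP 0 (_ - _)) => ?; lra.
Qed.

End MaxSpan.

Theorem corollary23 (R : realType) (n : nat) (K : set 'rV[R]_n)
    (openK : open_max_cone K)
    (unitK : forall p : 'I_n, ~ K (delta_mx ord0 p))
    (S : set 'rV[R]_n) (genS : generating_set S K) :
  totally_dependent S.
Proof.
move=> x Sx; have Kx := generating_set_sub _ _ genS _ Sx.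
case: (genS) => S_ge0 spanS; apply/max_spanP; split=> [|j nz].
  exact: S_ge0.
have [y [Ky yj y_le y_lt]] := open_max_cone_lower j openK Kx nz.
move: Ky; rewrite -spanS => /max_spanP[_ /(_ j)]; rewrite yj.
move=> /(_ nz)[s [l [Ss l_ge0 sy sj]]].
exists s, l; split=> // [|i]; last exact: le_trans (sy i) (y_le i).
(* If [s] were [x], touching at [j] would force [l = 1], hence [x <= y] entrywise, which fails at a
   second support entry [i]. *)
split=> //= sx; rewrite {}sx in sy sj.
have [i ij nzi] := max_cone_support _ _ _ openK.1 (unitK j) Kx nz.
have l1 : l = 1 by apply: (mulIf nz); rewrite mul1r.
by have := le_lt_trans (sy i) (y_lt i ij nzi); rewrite l1 mul1r ltxx.
Qed.
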